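(* Let $r>0$. For any density $f\in\mathcal{S}$ and for all $z\ge0$, $$\mathbb{P}\left(P_n\left(\ln(f/f_* )\right)\le-\frac{z}{nr}-\frac1r\ln\left(P\left[(f_*/f)^r\right]\right)\right)\le\exp(-z).$$ Moreover, if we can set a quantity $w_r$ which satisfies $w_r\ge\int\left(\frac{f_*^{r+1}}{f^r}\vee f_*\right)\left(\ln\left(\frac{f}{f_*}\right)\right)^2d\mu$, then for all $z\ge0$, $$\mathbb{P}\left((P_n-P)\left(\ln(f/f_* )\right)\le-\sqrt{\frac{2w_rz}{n}}-\frac{2z}{nr}\right)\le\exp(-z).$$
   Context: $(\mathcal{Z},\mathcal{T})$ is a measurable space, $\mu$ a known probability measure on it, and $\xi_1,\dots,\xi_n$ are $n$ independent observations with unknown common distribution $P$ on $(\mathcal{Z},\mathcal{T})$ admitting a density $f_*=dP/d\mu$ with respect to $\mu$. $P_n=\frac1n\sum_{i=1}^n\delta_{\xi_i}$ is the empirical distribution; for a function $g$ on $\mathcal{Z}$, $P(g)=P[g]=\int_{\mathcal{Z}} g\,dP$ and $P_n(g)=\frac1n\sum_{i=1}^n g(\xi_i)$. We write $a\vee b=\max(a,b)$. Conventions: $\ln0=-\infty$, $0\ln0=0$, and $(x)_+=x\vee 0$. The class $\mathcal{S}$ is $$\mathcal{S}=\left\{f:\mathcal{Z}\to\mathbb{R}_+;\ \int_{\mathcal{Z}}f\,d\mu=1\ \text{and}\ P(\ln f)_+<\infty\right\},$$ and it is assumed that $f_*\in\mathcal{S}$.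
   Formalization: The first inequality is stated for f with f > 0 P-almost surely; otherwise P[(f_*/f)^r] = +∞, the threshold is −∞, and with ln 0 = −∞ the event has a fixed positive probability, so the bound fails for large z. *)

(* Defs.v *)
From HB Require Import structures.
From mathcomp Require Export all_boot all_order all_algebra.
From mathcomp Require Export all_classical all_reals all_analysis.

Set Implicit Arguments.
Unset Strict Implicit.
Unset Printing Implicit Defensive.

Export Order.TTheory GRing.Theory Num.Theory.

Local Open Scope classical_set_scope.
Local Open Scope ring_scope.
Local Open Scope ereal_scope.

Section Defs.
Context {dZ dO : measure_display} {Z : measurableType dZ}
  {Omega : measurableType dO} {R : realType}.

Definition density_of (mu P : probability Z R) (f : Z -> R) : Prop :=
  [/\ measurable_fun setT f, forall x, (0 <= f x)%R &
      forall A, measurable A -> P A = \int[mu]_(x in A) (f x)%:E].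

(* [lne] is the extended logarithm, with [lne 0 = -oo]. *)
Definition class_S (mu P : probability Z R) (f : Z -> R) : Prop :=
  [/\ measurable_fun setT f, forall x, (0 <= f x)%R,
      \int[mu]_x (f x)%:E = 1 &
      \int[P]_x (maxe (lne (f x)%:E) 0) < +oo].

Definition mutually_independent (Pr : probability Omega R) (n : nat)
    (xi : 'I_n -> Omega -> Z) : Prop :=
  forall (J : {set 'I_n}) (A : 'I_n -> set Z), (forall i, measurable (A i)) ->
    Pr (\bigcap_(i in [set i | i \in J]) (xi i @^-1` A i)) =
    \prod_(i in J) Pr (xi i @^-1` A i).

Definition iid_sample (Pr : probability Omega R) (P : probability Z R)
    (n : nat) (xi : 'I_n -> Omega -> Z) : Prop :=
  [/\ forall i, measurable_fun setT (xi i),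
      forall i A, measurable A -> Pr (xi i @^-1` A) = P A &
      mutually_independent Pr xi].

Definition empirical_mean (n : nat) (xi : 'I_n -> Omega -> Z)
    (g : Z -> \bar R) (w : Omega) : \bar R :=
  (n%:R^-1)%:E * \sum_(i < n) g (xi i w).

(* Division is that of [\bar R], not of [R]: [a%:E / 0 = +oo] for [0 < a], and
   [0 / 0 = 0]; in [R] one would have [a / 0 = 0]. *)
Definition ratio (f g : Z -> R) (x : Z) : \bar R := (f x)%:E / (g x)%:E.

Definition log_ratio (f g : Z -> R) (x : Z) : \bar R := lne (ratio f g x).

(* Where [g] vanishes the integrand is [0], since [0 * +oo = 0] in [\bar R];
   where [f] vanishes and [g] does not it is [+oo]. *)
Definition weighted_sq_log (mu : probability Z R) (r : R) (f g : Z -> R) :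
    \bar R :=
  \int[mu]_x (maxe ((g x `^ (r + 1))%:E / (f x `^ r)%:E) (g x)%:E
              * log_ratio f g x ^+ 2).

End Defs.

(* Main.v *)
Require Import Defs.
From mathcomp Require Import measurable_realfun ring lra.

(** Both inequalities are Chernoff bounds for the sum of the independent
    variables [L(xi_i)], where [L = ln (fs / f)].

    For [a > 0] let [M = P[exp (a L)] = P[(fs / f) ^ a]].  By independence the
    expectation of [exp (a (L(xi_1) + ... + L(xi_n)))] is [M ^ n], and Markov's
    inequality gives, with probability at least [1 - exp (- z)], a mean of the
    [L(xi_i)] smaller than [z / (n a) + a^-1 ln M] ([chernoff_iid],
    [empirical_mean_deviation]).  With [a = r] this is the first inequality; when
    [M = +oo] its threshold is [-oo], which the mean almost surely exceeds.

    The second inequality bounds [M] for [0 < a <= r].  From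
    [exp x <= 1 + x + x ^ 2 / 2 * (exp x \/ 1)] ([expR_le_taylor2]) one gets
    [ln M <= a P[L] + a ^ 2 w / 2] as soon as
    [P[((fs / f) ^ r \/ 1) L ^ 2] <= w] ([expR_moment_bound]), and this is the
    hypothesis on [w] rewritten as an integral against [P]
    ([weighted_sq_logE]).  The mean of [L(xi_i) - P[L]] is then below
    [z / (n a) + a w / 2], and [bernstein_rate] selects [a].

    The logarithms and the ratios are extended reals, infinite or degenerate
    where [f] or [fs] vanishes.  That set is [P]-null: for [fs] because it is the
    density of [P], and for [f] by hypothesis in the first inequality, or because
    the weighted second moment would be infinite in the second.  All computations
    are thus carried out with the real function [log_gap] and transferred
    almost surely.  The independence hypothesis concerns events, and
    [ge0_iid_expectation_prod] extends it to expectations of products. *)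

Set Implicit Arguments.
Unset Strict Implicit.
Unset Printing Implicit Defensive.

Local Open Scope classical_set_scope.
Local Open Scope ring_scope.
Local Open Scope ereal_scope.

(** * Integrals and laws of independent samples *)

Section WeightedLaw.
Import HBNNSimple.

(** Two identities in one form.  With [X] the identity and [W] a density it is
    the change of measure; with [W] a product of factors independent of [X] and
    [c] its expectation it says that [E[W h(X)] = E[W] E[h(X)]] as soon as this
    holds for indicators [h].  Both sides are additive in [h] and commute with
    increasing limits, so the identity passes from indicators to simple
    functions and from these to [h]; as [c] and [W] are finite, multiplication
    by them is continuous and the limits can be taken. *)
Lemma ge0_integral_weighted_law (R : realType) (dZ dO : measure_display)
    (Z : measurableType dZ) (Omega : measurableType dO)
    (nu : {measure set Z -> \bar R}) (kappa : {measure set Omega -> \bar R})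
    (X : Omega -> Z) (W : Omega -> R) (c : R) (h : Z -> \bar R) :
  measurable_fun setT X -> measurable_fun setT W ->
  (forall w, (0 <= W w)%R) ->
  (forall A, measurable A ->
     c%:E * nu A = \int[kappa]_w (W w * \1_A (X w))%:E) ->
  measurable_fun [set: Z] h -> (forall x, 0 <= h x) ->
  c%:E * \int[nu]_x h x = \int[kappa]_w ((W w)%:E * h (X w)).
Proof.
move=> mX mW W0 law mh h0.
pose u := nnsfun_approx measurableT mh.
have u0 k x : 0 <= (u k x)%:E by rewrite lee_fin.
have nd_u x : {homo (fun k => (u k x)%:E) : a b / (a <= b)%N >-> a <= b}.
  by move=> a b ab; rewrite lee_fin; exact/lefP/nd_nnsfun_approx.
have ux x : EFin \o u ^~ x @ \oo --> h x by exact: cvg_nnsfun_approx.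
have mu_ k : measurable_fun setT (fun x => (u k x)%:E).
  by exact/measurable_EFinP/measurable_funP.
have simple k : c%:E * \int[nu]_x (u k x)%:E =
    \int[kappa]_w ((W w)%:E * (u k (X w))%:E).
  have mA a : measurable (u k @^-1` [set a]).
    by rewrite -[X in measurable X]setTI; exact: measurable_funP.
  have mind a : measurable_fun setT
      (fun w => W w * \1_(u k @^-1` [set a]) (X w))%R.
    apply: measurable_funM => //.
    by apply: measurableT_comp => //; exact: measurable_indic.
  have Wind0 a w : (0 <= W w * \1_(u k @^-1` [set a]) (X w))%R.
    by rewrite mulr_ge0// indicE.
  have aWind0 a w : 0 <= (a * (W w * \1_(u k @^-1` [set a]) (X w)))%:E.
    (* [a] may be negative, but then no point takes the value [a]. *)
    have := nnfun_muleindic_ge0 (u k) a (X w).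
    by rewrite -EFinM !lee_fin mulrCA => ?; rewrite mulr_ge0.
  rewrite integralT_nnsfun sintegralE ge0_mule_fsumr; last first.
    by move=> a; exact: nnsfun_mulemu_ge0.
  transitivity (\int[kappa]_w (\sum_(a \in range (u k))
      (a * (W w * \1_(u k @^-1` [set a]) (X w)))%:E)); last first.
    apply: eq_integral => w _.
    rewrite [in RHS](fimfunE (u k)) -EFinM fsumEFin// mulr_fsumr.
    by congr EFin; apply: eq_fsbigr => a _; rewrite mulrCA.
  rewrite ge0_integral_fsum//; last first.
    by move=> a; apply/measurable_EFinP; apply: measurable_funM.
  apply: eq_fsbigr => a; rewrite inE => -[x _ <-].
  rewrite muleCA law//.
  under [RHS]eq_integral do rewrite EFinM.
  rewrite ge0_integralZl_EFin//; last exact/measurable_EFinP.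
  by move=> w _; rewrite lee_fin.
have cvgl : (fun k => \int[nu]_x (u k x)%:E) @ \oo --> \int[nu]_x h x.
  rewrite (_ : (fun x => h x) = (fun x => limn (fun k => (u k x)%:E))).
    exact: cvg_monotone_convergence.
  by apply/funext => x; apply/esym/cvg_lim => //; exact: ux.
have cvgr : (fun k => \int[kappa]_w ((W w)%:E * (u k (X w))%:E)) @ \oo -->
    \int[kappa]_w ((W w)%:E * h (X w)).
  rewrite (_ : (fun w => (W w)%:E * h (X w)) =
      (fun w => limn (fun k => (W w)%:E * (u k (X w))%:E))).
    apply: cvg_monotone_convergence => //.
    - move=> k; apply: emeasurable_funM; first exact/measurable_EFinP.
      exact: measurableT_comp (mu_ k) mX.
    - by move=> k w _; rewrite mule_ge0 ?lee_fin.
    - by move=> w _ a b ab; rewrite lee_wpmul2l ?lee_fin//; exact: nd_u.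
  apply/funext => w; apply/esym/cvg_lim => //.
  by apply: cvgeZl => //; exact: ux.
apply: (cvg_unique _ _ cvgr) => //.
rewrite (_ : (fun k => _) = (fun k => c%:E * \int[nu]_x (u k x)%:E)).
  exact: cvgeZl.
by apply/funext => k; rewrite simple.
Qed.

End WeightedLaw.

(** Independence is given for events only; it extends to functions of the
    observations by replacing the indicators by functions one index at a time,
    each time by [ge0_integral_weighted_law] applied to the product of the other
    factors.  Finiteness of the integrals makes the product of the remaining
    expectations a real constant. *)
Lemma ge0_iid_expectation_prod (R : realType) (dZ dO : measure_display)
    (Z : measurableType dZ) (Omega : measurableType dO)
    (P : probability Z R) (Pr : probability Omega R)
    (n : nat) (xi : 'I_n -> Omega -> Z) (h : 'I_n -> Z -> R) :
  iid_sample Pr P xi ->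
  (forall i, measurable_fun setT (h i)) -> (forall i x, (0 <= h i x)%R) ->
  (forall i, \int[P]_x (h i x)%:E < +oo) ->
  \int[Pr]_w (\prod_(i < n) h i (xi i w))%:E =
  \prod_(i < n) \int[P]_x (h i x)%:E.
Proof.
move=> [mxi law indep].
have mxih g j : measurable_fun setT g ->
    measurable_fun setT (fun w => g (xi j w) : R).
  by move=> mg; exact: (measurableT_comp mg (mxi j)).
have int0 g : (forall x, (0 <= g x)%R) -> 0 <= \int[P]_x (g x)%:E.
  by move=> g0; apply: integral_ge0 => x _; rewrite lee_fin.
(* Mixed products, in which the factors of index at least [k] are indicators:
   for [k = 0] this is the independence of events, and each step frees one
   more factor. *)
suff partial k (g : 'I_n -> Z -> R) (A : 'I_n -> set Z) :
    (forall i, measurable_fun setT (g i)) -> (forall i x, (0 <= g i x)%R) ->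
    (forall i, \int[P]_x (g i x)%:E < +oo) ->
    (forall i, measurable (A i)) ->
    (forall i : 'I_n, (k <= i)%N -> g i = \1_(A i)) ->
    \int[Pr]_w (\prod_(i < n) g i (xi i w))%:E =
    \prod_(i < n) \int[P]_x (g i x)%:E.
  move=> mh h0 hoo; apply: (partial n h (fun=> setT)) => // i.
  by rewrite leqNgt ltn_ord.
elim: k g A => [|k IH] g A mg g0 goo mA gA.
  have gE i : g i = \1_(A i) by exact: gA.
  transitivity (\prod_(i < n) Pr (xi i @^-1` A i)); last first.
    by apply: eq_bigr => i _; rewrite gE integral_indic// setIT; exact: law.
  have := indep [set: 'I_n]%SET A mA.
  under eq_bigl do rewrite inE.
  move=> <-.
  rewrite -[X in Pr X]setIT -integral_indic//; last first.
    apply: fin_bigcap_measurable => // i _.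
    by rewrite -[X in measurable X]setTI; exact: mxi.
  apply: eq_integral => w _; congr EFin; rewrite indicE.
  have [wA|] := boolP (w \in _).
    rewrite big1// => i _; rewrite gE indicE mem_set//.
    by move: wA; rewrite inE => /(_ i); apply; rewrite /= inE.
  rewrite notin_setE => /existsNP[i /not_implyP[_ wAi]].
  by rewrite (bigD1 i)//= gE indicE memNset// mul0r.
have [kn|nk] := ltnP k n; last first.
  apply: (IH _ A) => // i ki; apply: gA.
  by have := leq_trans nk ki; rewrite leqNgt ltn_ord.
pose j := Ordinal kn.
pose W w : R := (\prod_(i < n | i != j) g i (xi i w))%R.
pose c : \bar R := \prod_(i < n | i != j) \int[P]_x (g i x)%:E.
have cfin : c \is a fin_num.
  by apply: prode_fin_num => i _; rewrite ge0_fin_numE// int0.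
rewrite [RHS](bigD1 j)//= -/c -(fineK cfin) muleC.
rewrite (@ge0_integral_weighted_law R _ _ Z Omega P Pr (xi j) W) => //.
- by apply: eq_integral => w _; rewrite (bigD1 j)//= mulrC EFinM.
- rewrite /W; under eq_fun do rewrite -big_filter.
  by apply: measurable_prod => i _; exact: mxih.
- by move=> w; apply: prodr_ge0.
- move=> B mB.
  pose g' i := if i == j then \1_B else g i.
  pose A' i := if i == j then B else A i.
  rewrite fineK//.
  transitivity (\prod_(i < n) \int[P]_x (g' i x)%:E).
    rewrite (bigD1 j)//= /g' eqxx integral_indic// setIT muleC; congr (_ * _).
    by apply: eq_bigr => i /negbTE ->.
  rewrite -(IH _ A').
  + apply: eq_integral => w _; rewrite (bigD1 j)//= /g' eqxx mulrC.
    congr (_ * _)%:E.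
    by apply: eq_bigr => i /negbTE ->.
  + by move=> i; rewrite /g'; case: eqP => // _; exact: measurable_indic.
  + by move=> i x; rewrite /g'; case: eqP => // _; rewrite indicE.
  + move=> i; rewrite /g'; case: eqP => // _.
    rewrite integral_indic// setIT.
    by rewrite (le_lt_trans (probability_le1 _ _))// ltry.
  + by move=> i; rewrite /A'; case: eqP.
  + move=> i ki; rewrite /g' /A'; case: eqP => // /eqP ij; apply: gA.
    by rewrite ltn_neqAle ki andbT eq_sym.
- exact/measurable_EFinP.
- by move=> x; rewrite lee_fin.
Qed.

(** Chernoff's bound: by independence the exponential of the sum has
    expectation at most [m ^ n], and Markov's inequality is applied to it at the
    level [exp z * m ^ n]. *)
Lemma chernoff_iid (R : realType) (dZ dO : measure_display)
    (Z : measurableType dZ) (Omega : measurableType dO)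
    (P : probability Z R) (Pr : probability Omega R)
    (n : nat) (xi : 'I_n -> Omega -> Z) (Y : Z -> R) (m z : R) :
  iid_sample Pr P xi -> measurable_fun setT Y -> (0 < m)%R ->
  \int[P]_x (expR (Y x))%:E <= m%:E ->
  Pr [set w | (z + n%:R * ln m <= \sum_(i < n) Y (xi i w))%R]
    <= (expR (- z))%:E.
Proof.
move=> iid mY m0 Ym.
have [mxi _ _] := iid.
pose S w : R := (\sum_(i < n) Y (xi i w))%R.
have mS : measurable_fun setT S.
  by apply: measurable_sum => i; exact: (measurableT_comp mY (mxi i)).
have EYfin : \int[P]_x (expR (Y x))%:E \is a fin_num.
  rewrite ge0_fin_numE ?(le_lt_trans Ym) ?ltry//.
  by apply: integral_ge0 => x _; rewrite lee_fin expR_ge0.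
have ES : \int[Pr]_w (expR (S w))%:E <= (m ^+ n)%:E.
  under eq_integral do rewrite expR_sum.
  rewrite (@ge0_iid_expectation_prod R _ _ Z Omega P Pr n xi
    (fun=> expR \o Y)) => //.
  - rewrite /comp -(fineK EYfin) prodEFin prodr_const card_ord lee_fin.
    rewrite lerXn2r ?nnegrE ?(ltW m0) -?lee_fin ?fineK//.
    by apply: integral_ge0 => x _; rewrite lee_fin expR_ge0.
  - by move=> _; exact: measurableT_comp.
  - by move=> _ x; exact: expR_ge0.
  - by move=> _; rewrite (le_lt_trans Ym)// ltry.
pose t : R := (z + n%:R * ln m)%R.
have := @le_integral_comp_abse _ _ R Pr setT measurableT
  (EFin \o (expR \o S)) (expR t) id (@measurable_id _ _ _).
rewrite setTI => markov.
have {}markov : (expR t)%:E * Pr [set w | (t <= S w)%R] <= (m ^+ n)%:E.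
  apply: le_trans ES.
  under eq_integral do rewrite -[expR _]ger0_norm ?expR_ge0//.
  apply: le_trans (markov _ _ _ _) => //=; last first.
  - exact: expR_gt0.
  - by apply/measurable_EFinP; exact: measurableT_comp.
  - rewrite (_ : [set x | _] = [set w | (t <= S w)%R])//.
    apply/seteqP; split=> w /=;
      by rewrite lee_fin ger0_norm ?expR_ge0// ler_expR.
rewrite -(@lee_pmul2l _ (expR t)%:E) ?lte_fin ?expR_gt0//.
apply: (le_trans markov); rewrite -EFinM lee_fin -expRD /t addrAC subrr add0r.
by rewrite expRM_natl lnK.
Qed.

(** The observations almost surely all avoid a [P]-null set; so an inclusion of
    events may be checked on the samples that avoid it. *)
Lemma iid_sample_le_ae (R : realType) (dZ dO : measure_display)
    (Z : measurableType dZ) (Omega : measurableType dO)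
    (P : probability Z R) (Pr : probability Omega R)
    (n : nat) (xi : 'I_n -> Omega -> Z) (N : set Z) (A B : set Omega) :
  iid_sample Pr P xi -> measurable N -> P N = 0 ->
  measurable A -> measurable B ->
  (forall w, A w -> (forall i, ~ N (xi i w)) -> B w) ->
  Pr A <= Pr B.
Proof.
move=> [mxi law _] mN PN mA mB AB.
pose M := \big[setU/set0]_(i < n) (xi i @^-1` N).
have mxiN i : measurable (xi i @^-1` N).
  by rewrite -[X in measurable X]setTI; exact: mxi.
have [mM M0] : measurable M /\ Pr M = 0.
  rewrite /M; elim/big_ind : _ => [|X Y [mX X0] [mY Y0]|i _].
  - by split => //; exact: measure0.
  - by split; [exact: measurableU|rewrite -X0; exact: measureU0].
  - by split => //; rewrite law.
rewrite -(measureU0 mB mM M0) le_measure ?inE//; first exact: measurableU.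
move=> w Aw; have [Mw|Mw] := pselect (M w); [by right|left].
by apply: AB => // i Ni; apply: Mw; rewrite /M (bigD1 i)//=; left.
Qed.

(** * Exponential moments *)

Section TaylorBound.
Import numFieldNormedType.Exports.
Local Open Scope ring_scope.

Lemma ge0_derive_le (R : realType) (g dg : R -> R) (x : R) :
  (forall y : R, is_derive y 1 g (dg y)) -> (forall y, 0 <= y -> 0 <= dg y) ->
  0 <= x -> g 0 <= g x.
Proof.
move=> gdg dg0; rewrite le_eqVlt => /predU1P[<-//|x0].
have [c /andP[c0 _] gxE] : exists2 c, 0 < c < x & g x - g 0 = dg c * (x - 0).
  have gc : {within `[0, x], continuous g}.
    apply: continuous_subspaceT => y.
    exact/differentiable_continuous/derivable1_diffP/ex_derive.
  have [c cx ?] := @MVT R g dg 0 x x0 (fun y _ => gdg y) gc.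
  by exists c => //; move: cx; rewrite in_itv.
by rewrite -subr_ge0 gxE subr0; exact: mulr_ge0 (dg0 _ (ltW c0)) (ltW x0).
Qed.

(** Taylor's formula with the second derivative bounded by its maximum between
    [0] and [x].  For [0 <= x] the claim times [exp (- x)] compares
    [(1 + x) exp (- x) + x ^ 2 / 2], of derivative [x (1 - exp (- x))], with its
    value at [0]; for [x < 0] one does the same with
    [1 - y + y ^ 2 / 2 - exp (- y)] at [y = - x]. *)
Lemma expR_le_taylor2 (R : realType) (x : R) :
  expR x <= 1 + x + x ^+ 2 / 2 * Num.max (expR x) 1.
Proof.
have [x0|x0] := leP 0 x.
- rewrite max_l; last by rewrite -[leLHS]expR0 ler_expR.
  have der (y : R) : is_derive y 1
      (fun y => (1 + y) * expR (- y) + y ^+ 2 / 2) (y * (1 - expR (- y))).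
    apply: is_derive_eq.
    by rewrite /GRing.scale /=; field.
  have := @ge0_derive_le R _ _ x der _ x0.
  rewrite oppr0 expR0 expr0n /= mul0r !addr0 mulr1 => h.
  have {}h : 1 <= (1 + x) * expR (- x) + x ^+ 2 / 2.
    by apply: h => y y0; rewrite mulr_ge0// subr_ge0 -expR0 ler_expR oppr_le0.
  rewrite -[X in X <= _]mulr1.
  apply: (le_trans (ler_wpM2l (expR_ge0 _) h)).
  by rewrite mulrDr mulrCA -expRD subrr expR0 mulr1 [_ * expR x]mulrC.
- rewrite max_r ?mulr1; last by rewrite -[leRHS]expR0 ler_expR ltW.
  have der (y : R) : is_derive y 1 (fun y => 1 - y + y ^+ 2 / 2 - expR (- y))
      (- 1 + y + expR (- y)).
    apply: is_derive_eq.
    by rewrite /GRing.scale /=; field.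
  have := @ge0_derive_le R _ _ (- x) der.
  rewrite oppr0 expR0 opprK sqrrN expr0n /= mul0r !addr0 subrr subr_ge0.
  apply; last by rewrite oppr_ge0 ltW.
  by move=> y _; have := expR_ge1Dx (- y); lra.
Qed.

End TaylorBound.

(** Integrate [expR_le_taylor2] at [a * L x].  The remainder is controlled by
    the hypothesis, because [exp (a L) \/ 1 <= exp (r L) \/ 1] whatever the sign
    of [L]; one concludes by [1 + t <= exp t].  The same hypothesis dominates
    [L ^ 2], which makes [L] integrable. *)
Lemma expR_moment_bound (R : realType) (dZ : measure_display)
    (Z : measurableType dZ) (P : probability Z R) (L : Z -> R) (r w a : R) :
  measurable_fun setT L -> (0 <= a <= r)%R ->
  \int[P]_x (Num.max (expR (r * L x)) 1 * L x ^+ 2)%:E <= w%:E ->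
  P.-integrable setT (EFin \o L) /\
  \int[P]_x (expR (a * L x))%:E <=
    (expR (a * fine (\int[P]_x (L x)%:E) + a ^+ 2 * w / 2))%:E.
Proof.
move=> mL /andP[a0 ar].
pose V x : R := (Num.max (expR (r * L x)) 1 * L x ^+ 2)%R.
rewrite -[X in X <= _]/(\int[P]_x (V x)%:E) => Vw.
have mV : measurable_fun setT V.
  apply: measurable_funM; last exact: measurable_funX.
  apply: measurable_maxr => //; apply: measurableT_comp => //.
  exact: measurable_funM.
have V_ge x : (L x ^+ 2 <= V x)%R.
  by rewrite ler_peMl ?sqr_ge0// le_max lexx orbT.
have V0 x : (0 <= V x)%R by rewrite (le_trans _ (V_ge x)) ?sqr_ge0.
have iV : P.-integrable setT (EFin \o V).
  apply/integrableP; split; first exact/measurable_EFinP.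
  under eq_integral do rewrite /= ger0_norm//.
  by rewrite (le_lt_trans Vw)// ltry.
have i1 : P.-integrable setT (EFin \o cst 1%R).
  exact: finite_measure_integrable_cst.
have iL : P.-integrable setT (EFin \o L).
  (* [|L| <= 1 + L ^ 2 <= 1 + V] *)
  apply: (@le_integrable _ _ _ _ _ measurableT _ (fun x => (1 + V x)%:E)).
  - exact/measurable_EFinP.
  - move=> x _; rewrite /= lee_fin [leRHS]ger0_norm ?addr_ge0//.
    apply: le_trans (lerD (lexx _) (V_ge x)); rewrite ler_norml.
    by apply/andP; split; nra.
  - exact: (integrableD measurableT i1 iV).
split=> //.
apply: (@le_trans _ _
    (\int[P]_x (1 + a%:E * (L x)%:E + (a ^+ 2 / 2)%:E * (V x)%:E))).
  apply: ge0_le_integral => //.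
  - apply/measurable_EFinP; apply: measurableT_comp => //.
    exact: measurable_funM.
  - apply/measurable_EFinP; apply: measurable_funD.
      by apply: measurable_funD => //; exact: measurable_funM.
    exact: measurable_funM.
  - move=> x _; rewrite -!EFinM -!EFinD lee_fin.
    apply: (le_trans (expR_le_taylor2 _)); rewrite lerD2l.
    rewrite (_ : _ / 2 * _ =
      a ^+ 2 / 2 * (Num.max (expR (a * L x)) 1 * L x ^+ 2))%R; last by field.
    rewrite ler_wpM2l ?divr_ge0 ?sqr_ge0// ler_wpM2r ?sqr_ge0//.
    rewrite ge_max; apply/andP; split; last by rewrite le_max lexx orbT.
    have [L0|L0] := leP 0%R (L x).
      by rewrite le_max ler_expR ler_wpM2r.
    rewrite le_max -[in X in _ || X]expR0 !ler_expR.
    by rewrite (_ : a * L x <= 0)%R ?orbT//; nra.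
rewrite integralD//; last 2 first.
- by apply: integrableD => //; exact: integrableZl.
- exact: integrableZl.
rewrite integralD//; last exact: integrableZl.
rewrite !integralZl// (_ : \int[P]_x 1 = 1); last first.
  by rewrite integral_cst// mul1e; exact: probability_setT.
have := integrable_fin_num measurableT iL.
have := integrable_fin_num measurableT iV.
move: Vw; rewrite /comp.
case: (\int[P]_x (V x)%:E) => // v; rewrite lee_fin => vw _.
case: (\int[P]_x (L x)%:E) => // EL _ /=.
rewrite -!EFinM -!EFinD lee_fin; apply: le_trans (expR_ge1Dx _).
by rewrite -addrA !lerD2l mulrAC ler_wpM2r ?invr_ge0// ler_wpM2l ?sqr_ge0.
Qed.

Lemma integral_expR_gt0 (R : realType) (dZ : measure_display)
    (Z : measurableType dZ) (P : probability Z R) (Y : Z -> R) :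
  measurable_fun setT Y -> 0 < \int[P]_x (expR (Y x))%:E.
Proof.
move=> mY; rewrite lt0e; apply/andP; split; last first.
  by apply: integral_ge0 => x _; rewrite lee_fin expR_ge0.
apply/eqP => int0.
have : \int[P]_x `|(expR (Y x))%:E| = 0.
  by under eq_integral do rewrite /= ger0_norm ?expR_ge0//.
have mexp : measurable_fun setT (fun x => (expR (Y x))%:E).
  by apply/measurable_EFinP; exact: measurableT_comp.
move=> /(ae_eq_integral_abs P measurableT mexp)[A [_ PA0 AT]].
have AE : A = setT.
  rewrite -subTset => x _; apply: AT => /= /(_ Logic.I)[] /eqP.
  by rewrite gt_eqF// expR_gt0.
have : P A = 1 by rewrite AE; exact: probability_setT.
by rewrite PA0 => /eqP; rewrite eq_sym onee_eq0.
Qed.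

(** Choice of the exponent in Chernoff's bound.  The unconstrained minimum of
    [z / (n a) + a w / 2] is at [a = sqrt (2 z / (n w))], where the two terms are
    equal and add up to [sqrt (2 w z / n)].  When this exceeds [r], or when
    [w = 0], take [a = r]: then [r w / 2 <= z / (n r)], which is where the
    factor [2] of the last term comes from. *)
Lemma bernstein_rate (R : realType) (r w z n : R) :
  (0 < r)%R -> (0 <= w)%R -> (0 < z)%R -> (0 < n)%R ->
  exists2 a : R, (0 < a <= r)%R &
    (z / (n * a) + a * w / 2 <= Num.sqrt (2 * w * z / n) + 2 * z / (n * r))%R.
Proof.
move=> r0 w0 z0 n0.
have [small|large] := leP (n * r ^+ 2 * w)%R (2 * z)%R.
  exists r; first by rewrite r0 lexx.
  have : (r * w / 2 <= z / (n * r))%R.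
    by rewrite ler_pdivlMr ?mulr_gt0//; lra.
  have := sqrtr_ge0 (2 * w * z / n).
  have -> : (2 * z / (n * r) = z / (n * r) + z / (n * r))%R.
    by field; rewrite !gt_eqF.
  lra.
have w_gt0 : (0 < w)%R.
  rewrite lt0r w0 andbT; apply/eqP => w0'; move: large; rewrite w0' mulr0; lra.
pose q : R := (2 * z / (n * w))%R.
have q0 : (0 < q)%R by rewrite divr_gt0 ?mulr_gt0.
pose a : R := Num.sqrt q.
have a0 : (0 < a)%R by rewrite sqrtr_gt0.
have a2 : (a ^+ 2 = q)%R by rewrite sqr_sqrtr// ltW.
exists a.
  rewrite a0 /= -ler_sqr ?nnegrE ?(ltW a0) ?(ltW r0)// a2 /q.
  by rewrite ler_pdivrMr ?mulr_gt0//; nra.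
have -> : Num.sqrt (2 * w * z / n) = (a * w)%R.
  have -> : (2 * w * z / n = (a * w) ^+ 2)%R.
    by rewrite exprMn a2 /q; field; rewrite !gt_eqF.
  by rewrite sqrtr_sqr ger0_norm// mulr_ge0// ltW.
have -> : (z / (n * a) = a * w / 2)%R.
  have -> : (z = n * w * a ^+ 2 / 2)%R.
    by rewrite a2 /q; field; rewrite !gt_eqF.
  by field; rewrite !gt_eqF.
have : (0 <= 2 * z / (n * r))%R by rewrite divr_ge0 ?mulr_ge0// ltW.
lra.
Qed.

(** * Likelihood ratios in the extended reals *)

Lemma measurable_lne (R : realType) : measurable_fun [set: \bar R] (@lne R).
Proof.
rewrite (_ : @lne R = fun y => if y == +oo then +oo else
  if y <= 0 then -oo else (ln (fine y))%:E); last first.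
  by apply/funext => -[s| |] //=; rewrite ?lee_fin ?leNye.
apply: measurable_fun_ifT => //=; first exact: measurable_fun_eqe.
apply: measurable_fun_ifT => //=; first exact: measurable_fun_lee.
by apply/measurable_EFinP; exact: measurableT_comp.
Qed.

Lemma measurable_ratio (R : realType) (dZ : measure_display)
    (Z : measurableType dZ) (f g : Z -> R) :
  measurable_fun setT f -> measurable_fun setT g -> (forall x, (0 <= g x)%R) ->
  measurable_fun setT (ratio f g).
Proof.
move=> mf mg g0.
rewrite (_ : ratio f g = fun x =>
    if g x == 0%R then (f x)%:E * +oo else (f x / g x)%:E); last first.
  by apply/funext => x; rewrite /ratio /inve/=; case: eqP.
apply: measurable_fun_ifT => //=.
- exact: measurable_fun_eqr.
- by apply: emeasurable_funM => //; exact/measurable_EFinP.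
- apply/measurable_EFinP; apply: measurable_funM => //.
  rewrite (_ : (fun x => _) = (fun x => g x `^ (- 1))%R).
    exact: measurableT_comp (measurable_powR _) mg.
  by apply/funext => x; rewrite powR_inv1.
Qed.

Lemma measurable_zero_set (R : realType) (dZ : measure_display)
    (Z : measurableType dZ) (g : Z -> R) :
  measurable_fun setT g -> measurable [set x | g x = 0%R].
Proof.
move=> mg; rewrite -[X in measurable X]setTI.
exact: (mg measurableT [set 0%R]).
Qed.

Lemma density_gt0_ae (R : realType) (dZ : measure_display)
    (Z : measurableType dZ) (mu P : probability Z R) (fs : Z -> R) :
  density_of mu P fs -> P [set x | fs x = 0%R] = 0.
Proof.
move=> [mfs _ ->]; last exact: measurable_zero_set.
by apply: integral0_eq => x /= ->.
Qed.

Section LogRatio.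
Context {dZ : measure_display} {Z : measurableType dZ} {R : realType}.
Variables (P : probability Z R) (fs f : Z -> R).
Hypotheses (mfs : measurable_fun setT fs) (fs0 : forall x, (0 <= fs x)%R).
Hypotheses (mf : measurable_fun setT f) (f0 : forall x, (0 <= f x)%R).

(** The real-valued logarithm of [fs / f], that is [- log_ratio f fs] where the
    latter is finite; the convention [ln 0 = 0] keeps it real on [zeros]. *)
Definition log_gap (x : Z) : R := (ln (fs x) - ln (f x))%R.
Definition zeros : set Z := [set x | f x = 0%R] `|` [set x | fs x = 0%R].

Lemma measurable_log_gap : measurable_fun setT log_gap.
Proof. by apply: measurable_funB; exact: measurableT_comp. Qed.

Lemma measurable_zeros : measurable zeros.
Proof. by apply: measurableU; exact: measurable_zero_set. Qed.

Lemma not_zeros x : ~ zeros x -> (0 < f x)%R /\ (0 < fs x)%R.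
Proof.
move=> Nx; split; rewrite lt0r ?f0 ?fs0 andbT.
  by apply/eqP => fx; apply: Nx; left.
by apply/eqP => fx; apply: Nx; right.
Qed.

Lemma ratio_log_gap x : ~ zeros x -> ratio fs f x = (expR (log_gap x))%:E.
Proof.
move=> /not_zeros[fx fsx]; rewrite /ratio /inve gt_eqF// -EFinM.
by rewrite /log_gap expRB !lnK.
Qed.

Lemma log_ratio_log_gap x : ~ zeros x -> log_ratio f fs x = (- log_gap x)%:E.
Proof.
move=> /not_zeros[fx fsx]; rewrite /log_ratio /ratio /inve gt_eqF// -EFinM.
by rewrite lne_EFin ?divr_gt0// ln_div ?posrE// /log_gap opprB.
Qed.

Lemma poweR_ratio_log_gap r x :
  ~ zeros x -> ratio fs f x `^ r = (expR (r * log_gap x))%:E.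
Proof.
move=> /ratio_log_gap->.
by rewrite poweR_EFin /powR gt_eqF ?expR_gt0// expRK.
Qed.

Lemma measurable_log_ratio : measurable_fun setT (log_ratio f fs).
Proof.
exact: measurableT_comp (@measurable_lne R) (measurable_ratio mf mfs fs0).
Qed.

(** The integrand of [weighted_sq_log] divided by [fs]. *)
Definition weighted_sq r x : \bar R :=
  maxe (ratio fs f x `^ r) 1 * log_ratio f fs x ^+ 2.

Lemma measurable_poweR_ratio r :
  measurable_fun setT (fun x => ratio fs f x `^ r).
Proof.
exact: measurableT_comp (measurable_poweR r) (measurable_ratio mfs mf f0).
Qed.

Lemma measurable_weighted_sq r : measurable_fun setT (weighted_sq r).
Proof.
apply: emeasurable_funM.
  by apply: measurable_maxe => //; exact: measurable_poweR_ratio.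
by apply: emeasurable_funM; exact: measurable_log_ratio.
Qed.

Lemma weighted_sq_ge0 r x : 0 <= weighted_sq r x.
Proof.
rewrite /weighted_sq mule_ge0//; first by rewrite le_max lee01 orbT.
rewrite expe2; case: (log_ratio f fs x) => [s| |].
- by rewrite -EFinM lee_fin -expr2 sqr_ge0.
- by rewrite mulyy.
- by rewrite mulNyNy.
Qed.

(** Change of measure from [mu] to [P].  Pointwise the integrands agree also
    where a density vanishes: both are [0] where [fs = 0], and both are [+oo]
    where [f = 0 < fs]. *)
Lemma weighted_sq_logE (mu : probability Z R) r :
  density_of mu P fs -> (0 < r)%R ->
  weighted_sq_log mu r f fs = \int[P]_x weighted_sq r x.
Proof.
move=> [_ _ PE] r0.
rewrite -[RHS]mul1e (@ge0_integral_weighted_law R _ _ Z Z P mu id fs 1%R) => //.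
- apply: eq_integral => x _; rewrite /weighted_sq.
  have [fsx|fsx] := eqVneq (fs x) 0%R.
    by rewrite fsx powR0 ?gt_eqF ?addr_gt0// mul0e maxxx !mul0e.
  have fs_gt0 : (0 < fs x)%R by rewrite lt0r fsx fs0.
  have [fx|fx] := eqVneq (f x) 0%R.
    rewrite /log_ratio /ratio fx powR0 ?gt_eqF// mul0e inve0 /= lexx.
    have mulE (a : R) : (0 < a)%R -> a%:E * +oo = +oo.
      by move=> a0; apply: gt0_muley; rewrite lte_fin.
    rewrite mulNyNy !mulE ?powR_gt0// poweRyr ?gt_eqF// !maxye mulyy.
    by rewrite mulE.
  have f_gt0 : (0 < f x)%R by rewrite lt0r fx f0.
  have Nx : ~ zeros x by case=> /eqP; apply/negP.
  rewrite log_ratio_log_gap// poweR_ratio_log_gap// [RHS]muleA; congr (_ * _).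
  rewrite /inve gt_eqF ?powR_gt0// -EFinM -!EFin_max -EFinM; congr EFin.
  rewrite maxr_pMr// mulr1; congr Num.max.
  rewrite -[X in (_ = X * _)%R](lnK fs_gt0) /powR !gt_eqF// -expRN -!expRD.
  by congr expR; rewrite /log_gap; ring.
- move=> A mA; rewrite mul1e; apply: (etrans (PE _ mA)).
  rewrite [LHS]integral_mkcond; apply: eq_integral => x _.
  by rewrite /= epatch_indic EFinM.
- exact: measurable_weighted_sq.
- exact: weighted_sq_ge0.
Qed.

(** Finiteness of the weighted second moment forces [f > 0] almost surely, since
    [weighted_sq] is infinite where [f] vanishes and [fs] does not. *)
Lemma null_zeros_of_weighted_sq r :
  P [set x | fs x = 0%R] = 0 -> (0 < r)%R ->
  \int[P]_x weighted_sq r x < +oo -> P [set x | f x = 0%R] = 0.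
Proof.
move=> Pfs0 r0 foo.
have int : P.-integrable setT (weighted_sq r).
  apply/integrableP; split; first exact: measurable_weighted_sq.
  by under eq_integral do rewrite gee0_abs ?weighted_sq_ge0//.
apply/negligibleP; first exact: measurable_zero_set.
have fs_negl : P.-negligible [set x | fs x = 0%R].
  by apply/negligibleP; first exact: measurable_zero_set.
have := integrable_ae measurableT int.
move=> /(negligibleU fs_negl); apply: negligibleS => x /= fx.
have [fsx|fsx] := eqVneq (fs x) 0%R; [by left|right => /= /(_ Logic.I)].
have fs_gt0 : (0 < fs x)%R by rewrite lt0r fsx fs0.
have ratioE : ratio fs f x = +oo.
  by rewrite /ratio fx inve0; apply: gt0_muley; rewrite lte_fin.
rewrite /weighted_sq ratioE poweRyr ?gt_eqF// maxye.
by rewrite /log_ratio /ratio fx mul0e /= lexx mulNyNy mulyy.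
Qed.

Section NullZeros.
Hypothesis Pz : P zeros = 0.

Lemma ae_eq_zeros (g h : Z -> \bar R) :
  (forall x, ~ zeros x -> g x = h x) -> ae_eq P setT g h.
Proof.
move=> gh; exists zeros; split; [exact: measurable_zeros|exact: Pz|].
by move=> x /= ghx; apply: contrapT => Nx; apply: ghx => _; exact: gh.
Qed.

Lemma integral_poweR_ratio r :
  \int[P]_x (ratio fs f x `^ r) = \int[P]_x (expR (r * log_gap x))%:E.
Proof.
apply: ge0_ae_eq_integral => //.
- exact: measurable_poweR_ratio.
- apply/measurable_EFinP; apply: measurableT_comp => //.
  by apply: measurable_funM => //; exact: measurable_log_gap.
- by move=> x _; exact: poweR_ge0.
- by apply: ae_eq_zeros => x; exact: poweR_ratio_log_gap.
Qed.

Lemma integral_weighted_sq r :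
  \int[P]_x weighted_sq r x =
  \int[P]_x (Num.max (expR (r * log_gap x)) 1 * log_gap x ^+ 2)%:E.
Proof.
have mL := measurable_log_gap.
apply: ge0_ae_eq_integral => //.
- exact: measurable_weighted_sq.
- apply/measurable_EFinP; apply: measurable_funM; last exact: measurable_funX.
  apply: measurable_maxr => //; apply: measurableT_comp => //.
  exact: measurable_funM.
- by move=> x _; exact: weighted_sq_ge0.
- by move=> x _; rewrite lee_fin mulr_ge0 ?sqr_ge0// le_max ler01 orbT.
- apply: ae_eq_zeros => x Nx.
  rewrite /weighted_sq poweR_ratio_log_gap// log_ratio_log_gap//.
  by rewrite -EFin_max expe2 -!EFinM mulrNN -expr2.
Qed.

Lemma integral_log_ratio :
  P.-integrable setT (EFin \o log_gap) ->
  \int[P]_x log_ratio f fs x = - \int[P]_x (log_gap x)%:E.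
Proof.
move=> iL; rewrite -integralN; last exact: integrable_add_def.
apply: ae_eq_integral => //.
- exact: measurable_log_ratio.
- by apply/measurable_EFinP/measurable_funN; exact: measurable_log_gap.
- by apply: ae_eq_zeros => x; exact: log_ratio_log_gap.
Qed.

(** * Deviations of the empirical mean *)

Section Sample.
Context {dO : measure_display} {Omega : measurableType dO}.
Variables (Pr : probability Omega R) (n : nat) (xi : 'I_n -> Omega -> Z).
Hypotheses (n_gt0 : (0 < n)%N) (iid : iid_sample Pr P xi).

Lemma measurable_empirical_mean_le (c : \bar R) :
  measurable [set w | empirical_mean xi (log_ratio f fs) w <= c].
Proof.
have [mxi _ _] := iid.
rewrite -[X in measurable X]setTI; apply: emeasurable_fun_infty_c => //.
apply: emeasurable_funM => //; apply: emeasurable_sum => i.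
exact: measurableT_comp measurable_log_ratio (mxi i).
Qed.

Lemma empirical_mean_log_gap w : (forall i, ~ zeros (xi i w)) ->
  empirical_mean xi (log_ratio f fs) w =
  (- (n%:R^-1 * \sum_(i < n) log_gap (xi i w)))%:E.
Proof.
move=> Nw; rewrite /empirical_mean.
under eq_bigr do rewrite log_ratio_log_gap//.
by rewrite sumEFin -EFinM sumrN mulrN.
Qed.

(** The exponent [a] stays free: it is [r] in the first inequality and comes
    from [bernstein_rate] in the second.  Off the null set of samples that meet
    [zeros], the event is contained in that of [chernoff_iid] for
    [a * log_gap]. *)
Lemma empirical_mean_deviation (a m z : R) (c : \bar R) :
  (0 < a)%R -> (0 < m)%R -> \int[P]_x (expR (a * log_gap x))%:E <= m%:E ->
  c <= (- (z / (n%:R * a)) - a^-1 * ln m)%:E ->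
  Pr [set w | empirical_mean xi (log_ratio f fs) w <= c] <= (expR (- z))%:E.
Proof.
move=> a0 m0 expm cle.
have maL : measurable_fun setT (fun x => a * log_gap x)%R.
  by apply: measurable_funM => //; exact: measurable_log_gap.
apply: le_trans (chernoff_iid z iid maL m0 expm).
have [mxi _ _] := iid.
apply: (iid_sample_le_ae iid measurable_zeros Pz).
- exact: measurable_empirical_mean_le.
- rewrite -[X in measurable X]setTI.
  have mS : measurable_fun setT (fun w => \sum_(i < n) a * log_gap (xi i w))%R.
    by apply: measurable_sum => i; exact: (measurableT_comp maL (mxi i)).
  rewrite setTI (_ : [set w | _] =
      (fun w => \sum_(i < n) a * log_gap (xi i w))%R
        @^-1` `[(z + n%:R * ln m)%R, +oo[).
    by rewrite -[X in measurable X]setTI; exact: mS.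
  by apply/seteqP; split => w /=; rewrite in_itv/= andbT.
- move=> w /= mean_le Nw.
  (* Multiply the inequality on the mean by [- n a]. *)
  move: (le_trans mean_le cle); rewrite empirical_mean_log_gap// lee_fin.
  rewrite -mulr_sumr.
  have n0 : (0 < n%:R :> R)%R by rewrite ltr0n.
  set S := (\sum_(i < n) _)%R => h.
  have {}h : (z / (n%:R * a) + a^-1 * ln m <= n%:R^-1 * S)%R by lra.
  have -> : (z + n%:R * ln m = (n%:R * a) * (z / (n%:R * a) + a^-1 * ln m))%R.
    by field; rewrite !gt_eqF.
  have -> : (a * S = (n%:R * a) * (n%:R^-1 * S))%R.
    by field; rewrite gt_eqF.
  by rewrite ler_wpM2l// mulr_ge0// ltW.
Qed.

End Sample.
End NullZeros.
End LogRatio.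

Theorem proposition4p5 (R : realType) (dZ dO : measure_display)
    (Z : measurableType dZ) (Omega : measurableType dO)
    (mu P : probability Z R) (Pr : probability Omega R)
    (fs : Z -> R) (n : nat) (xi : 'I_n -> Omega -> Z) (r : R) (f : Z -> R)
    (n_gt0 : (0 < n)%N)
    (fs_density : density_of mu P fs)
    (fs_S : class_S mu P fs)
    (xi_iid : iid_sample Pr P xi)
    (r_gt0 : (0 < r)%R)
    (f_S : class_S mu P f) :
  (P [set x | f x = 0%R] = 0 ->
   forall z : R, (0 <= z)%R ->
     Pr [set w | empirical_mean xi (log_ratio f fs) w <=
                 (- (z / (n%:R * r)))%:E
                 - (r^-1)%:E * lne (\int[P]_x (ratio fs f x `^ r))]
       <= (expR (- z))%:E)
  /\
  (forall wr : R, weighted_sq_log mu r f fs <= wr%:E ->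
   forall z : R, (0 <= z)%R ->
     Pr [set w | empirical_mean xi (log_ratio f fs) w
                 - \int[P]_x log_ratio f fs x <=
                 (- Num.sqrt (2 * wr * z / n%:R) - 2 * z / (n%:R * r))%:E]
       <= (expR (- z))%:E).
Proof.
have [mf f0 _ _] := f_S.
have [mfs fs0 _] := fs_density.
have Pfs0 := density_gt0_ae fs_density.
have Pz : P [set x | f x = 0%R] = 0 -> P (zeros fs f) = 0.
  by move=> Pf0; rewrite -Pf0; apply: measureU0 => //;
    exact: measurable_zero_set.
have mL := measurable_log_gap mfs mf.
split=> [/Pz {}Pz z _|w w_ge z z0].
- rewrite (integral_poweR_ratio mfs fs0 mf f0 Pz).
  have : 0 < \int[P]_x (expR (r * log_gap fs f x))%:E.
    apply: (@integral_expR_gt0 _ _ _ P (fun x => r * log_gap fs f x)%R).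
    exact: measurable_funM.
  case ME : (\int[P]_x (expR (r * log_gap fs f x))%:E) => [m| |//] m0.
  + apply: (empirical_mean_deviation mfs fs0 mf f0 Pz n_gt0 xi_iid r_gt0 m0).
      by rewrite ME.
    by rewrite lne_EFin.
  + (* The threshold is [-oo], while the mean is almost surely real. *)
    rewrite /= gt0_muley ?lte_fin ?invr_gt0// addeNy.
    apply: (@le_trans _ _ (Pr set0)); last by rewrite measure0 lee_fin expR_ge0.
    apply: (iid_sample_le_ae xi_iid (measurable_zeros mfs mf) Pz) => //.
      exact: (measurable_empirical_mean_le mfs fs0 mf xi_iid).
    by move=> v /= + Nv; rewrite (empirical_mean_log_gap fs0 f0).
- move: w_ge; rewrite (weighted_sq_logE mfs fs0 mf f0 fs_density)// => w_ge.
  have {}Pz : P (zeros fs f) = 0.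
    apply/Pz/(null_zeros_of_weighted_sq mfs fs0 mf f0 Pfs0 r_gt0).
    by rewrite (le_lt_trans w_ge)// ltry.
  have w0 : (0 <= w)%R.
    rewrite -lee_fin (le_trans _ w_ge)//.
    by apply: integral_ge0 => x _; exact: weighted_sq_ge0.
  move: w_ge; rewrite (integral_weighted_sq mfs fs0 mf f0 Pz) => w_ge.
  have r_itv : (0 <= r <= r)%R by rewrite lexx ltW.
  have [iL _] := expR_moment_bound mL r_itv w_ge.
  rewrite (integral_log_ratio mfs fs0 mf f0 Pz iL).
  have := integrable_fin_num measurableT iL.
  case ELE : (\int[P]_x (EFin \o log_gap fs f) x) => [EL| |] // _.
  rewrite oppeK.
  under eq_set do rewrite -leeBrDr//.
  have [z_gt0|] := ltP 0%R z; last first.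
    move=> z_le0; have -> : z = 0%R by apply/eqP; rewrite eq_le z_le0.
    rewrite oppr0 expR0; apply: probability_le1.
    exact: (measurable_empirical_mean_le mfs fs0 mf xi_iid).
  have n0 : (0 < n%:R :> R)%R by rewrite ltr0n.
  have [a /andP[a0 ar] rate] := bernstein_rate r_gt0 w0 z_gt0 n0.
  have a_itv : (0 <= a <= r)%R by rewrite ar ltW.
  have [_ expm] := expR_moment_bound mL a_itv w_ge.
  apply: (empirical_mean_deviation mfs fs0 mf f0 Pz n_gt0 xi_iid a0
    (expR_gt0 _) expm).
  rewrite ELE /= expRK -EFinB lee_fin.
  have -> : (a^-1 * (a * EL + a ^+ 2 * w / 2) = EL + a * w / 2)%R.
    by field; rewrite gt_eqF.
  move: rate; lra.
Qed.
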